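(* Let $D=K^3(e_1,e_2,e_3,e_1+e_2,e_2+e_3,e_3+e_1)\subset\mathbb{R}^3$ and let $P=K^2(e_1,e_2,e_1+e_2,e_1-e_2)\subset\mathbb{R}^2$ (a regular octagon). Then for every integer $k\ge1$: the Cartesian power $P^k\subset\mathbb{R}^{2k}$ is not a universal cover (in dimension $d=2k$), and $D\times P^{k-1}\subset\mathbb{R}^{2k+1}$ is not a universal cover (in dimension $d=2k+1$).
   Context: A convex set $K\subset\mathbb{R}^d$ is a universal cover if for every set $X\subset\mathbb{R}^d$ of diameter $1$ there exist $A\in O(d)$ and $b\in\mathbb{R}^d$ such that $X\subset A(K)+b$. $K^d(v_1,\dots,v_n):=\{x\in\mathbb{R}^d:\ |\langle x,v_i\rangle|\le\frac12\|v_i\|\text{ for all }i\}$, and $e_1,e_2,\dots$ denote the standard basis vectors. *)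

(* Defs.v *)
From mathcomp Require Import all_boot all_order all_algebra.
From mathcomp Require Import boolp classical_sets reals ereal interval_inference.
From mathcomp Require Import convex.

Set Implicit Arguments.
Unset Strict Implicit.
Unset Printing Implicit Defensive.

Import Order.TTheory GRing.Theory Num.Theory.

Local Open Scope classical_set_scope.
Local Open Scope ring_scope.

(* Points of R^d are row vectors.  Inner product and norm are defined here
   because the norm MathComp-Analysis puts on matrices is the sup norm. *)

Definition dotp (R : realType) (d : nat) (u v : 'rV[R]_d) : R :=
  \sum_(i < d) u 0 i * v 0 i.

Definition enorm (R : realType) (d : nat) (u : 'rV[R]_d) : R :=
  Num.sqrt (dotp u u).

(* Extended-real valued: +oo on unbounded sets, -oo on the empty set. *)
Definition diameter (R : realType) (d : nat) (X : set 'rV[R]_d) : \bar R :=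
  ereal_sup [set (enorm (p.1 - p.2))%:E | p in X `*` X].

Definition orthogonal_mx (R : realType) (d : nat) (A : 'M[R]_d) : Prop :=
  A *m A^T = 1%:M.

(* [y *m A^T] is the row form of the column vector A y. *)
Definition universal_cover (R : realType) (d : nat) (K : set 'rV[R]_d) : Prop :=
  convex_set K /\
  forall X : set 'rV[R]_d, diameter X = 1%E ->
    exists (A : 'M[R]_d) (b : 'rV[R]_d),
      orthogonal_mx A /\ X `<=` [set y *m A^T + b | y in K].

Definition slabs (R : realType) (d : nat) (vs : seq 'rV[R]_d) : set 'rV[R]_d :=
  [set x | forall v, v \in vs -> `|dotp x v| <= 2^-1 * enorm v].

(* Indices start at 0: [ebasis R i] is the (i+1)-st standard basis vector. *)
Definition ebasis (R : realType) (d : nat) (i : 'I_d) : 'rV[R]_d :=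
  delta_mx 0 i.

Definition setD3 (R : realType) : set 'rV[R]_3 :=
  let e := @ebasis R 3 in
  slabs [:: e 0; e 1; e 2; e 0 + e 1; e 1 + e 2; e 2 + e 0].
Arguments setD3 R _ : clear implicits.

Definition octagon (R : realType) : set 'rV[R]_2 :=
  let e := @ebasis R 2 in
  slabs [:: e 0; e 1; e 0 + e 1; e 0 - e 1].
Arguments octagon R _ : clear implicits.

Definition rV_prod (R : realType) (m n : nat)
    (A : set 'rV[R]_m) (B : set 'rV[R]_n) : set 'rV[R]_(m + n) :=
  [set x | A (lsubmx x) /\ B (rsubmx x)].

(* [vec_mx] cuts a vector of length k * n into the k rows, of length n, of a
   k x n matrix. *)
Definition rV_power (R : realType) (n : nat) (A : set 'rV[R]_n) (k : nat) :
    set 'rV[R]_(k * n) :=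
  [set x | forall i : 'I_k, A (row i (vec_mx x))].
Arguments rV_power {R n} A k _.

(* The sets above are convex, so [~ universal_cover] is, for them, the failure
   of the covering property. *)

Lemma dotp_conv (R : realType) (d : nat) (a b : R) (x y v : 'rV[R]_d) :
  dotp (a *: x + b *: y) v = a * dotp x v + b * dotp y v.
Proof.
rewrite /dotp !mulr_sumr -big_split /=; apply: eq_bigr => i _.
by rewrite !mxE mulrDl !mulrA.
Qed.

Lemma convex_slabs (R : realType) (d : nat) (vs : seq 'rV[R]_d) :
  convex_set (slabs vs).
Proof.
move=> x y t /set_mem xK /set_mem yK; apply/mem_set => v vvs.
rewrite [X in dotp X _](_ : _ = t%:num *: x + (1 - t%:num) *: y)//.
rewrite dotp_conv.
have t0 : 0 <= t%:num by [].
have t1 : 0 <= 1 - t%:num by rewrite subr_ge0.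
rewrite (le_trans (ler_normD _ _))// !normrM (ger0_norm t0) (ger0_norm t1).
have -> : 2^-1 * enorm v = t%:num * (2^-1 * enorm v)
                         + (1 - t%:num) * (2^-1 * enorm v).
  by rewrite -mulrDl subrKC mul1r.
by rewrite lerD// ler_wpM2l// ?xK ?yK.
Qed.

Lemma convex_rV_prod (R : realType) (m n : nat)
    (A : set 'rV[R]_m) (B : set 'rV[R]_n) :
  convex_set A -> convex_set B -> convex_set (rV_prod A B).
Proof.
move=> cA cB x y t /set_mem[xA xB] /set_mem[yA yB]; apply/mem_set; split.
- rewrite [lsubmx _](_ : _ = t%:num *: lsubmx x + (1 - t%:num) *: lsubmx y).
    by apply/set_mem/cA; exact/mem_set.
  by apply/rowP => i; rewrite !mxE.
- rewrite [rsubmx _](_ : _ = t%:num *: rsubmx x + (1 - t%:num) *: rsubmx y).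
    by apply/set_mem/cB; exact/mem_set.
  by apply/rowP => i; rewrite !mxE.
Qed.

Lemma convex_rV_power (R : realType) (n : nat) (A : set 'rV[R]_n) (k : nat) :
  convex_set A -> convex_set (rV_power A k).
Proof.
move=> cA x y t /set_mem xA /set_mem yA; apply/mem_set => i.
rewrite [row _ _](_ : _ = t%:num *: row i (vec_mx x)
                        + (1 - t%:num) *: row i (vec_mx y)).
  by apply/set_mem/cA; exact/mem_set.
by apply/rowP => j; rewrite !mxE.
Qed.

Lemma convex_octagon_power (R : realType) (k : nat) :
  convex_set (rV_power (octagon R) k).
Proof. by apply: convex_rV_power; exact: convex_slabs. Qed.

Lemma convex_D_octagon_power (R : realType) (k : nat) :
  convex_set (rV_prod (setD3 R) (rV_power (octagon R) k)).
Proof.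
by apply: convex_rV_prod; [exact: convex_slabs | exact: convex_octagon_power].
Qed.

(* Main.v *)
Require Import Defs.
From mathcomp Require Import all_boot all_order all_algebra.
From mathcomp Require Import classical_sets reals.
From mathcomp Require Import ereal ring lra.

(** Let [h] be the support function [|u| / 2 + eps * <u, e>^3 / |u|^2] of a small
odd perturbation of a ball, with [e] a unit vector, and let [X] be the set of
its gradients at unit vectors. For small [eps], [X] has diameter 1, and it has
width 1 in every direction. So if a congruent copy of [K] contains [X], every
slab of width 1 that contains [K] is tight, and the midpoint of [X] in the
direction of that slab is the one given by the translation. In the coordinates
of [K] this says [<v, c>^3 = |v|^2 <v, beta>] for a unit vector [c] (the rotated
[e]), a vector [beta] and every slab normal [v]: the cubic form [<v, c>^3] agrees
with a linear form on the unit normals. For the normals of the octagon and of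
[D] this forces the component of [c] in the corresponding factor to vanish, so
[c = 0]. *)

Set Implicit Arguments.
Unset Strict Implicit.
Unset Printing Implicit Defensive.

Import Order.TTheory GRing.Theory Num.Theory.

Local Open Scope classical_set_scope.
Local Open Scope ring_scope.

(** * Algebra of the Euclidean inner product *)

Section DotProduct.
Context {R : realType} {d : nat}.
Implicit Types (u v w e : 'rV[R]_d) (A : 'M[R]_d).

Lemma dotpE u v : dotp u v = (u *m v^T) 0 0.
Proof. by rewrite /dotp mxE; apply: eq_bigr => i _; rewrite mxE. Qed.

Lemma dotpC u v : dotp u v = dotp v u.
Proof. by apply: eq_bigr => i _; rewrite mulrC. Qed.

Lemma dotpDl u v w : dotp (u + v) w = dotp u w + dotp v w.
Proof. by rewrite !dotpE mulmxDl mxE. Qed.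

Lemma dotpZl a u w : dotp (a *: u) w = a * dotp u w.
Proof. by rewrite !dotpE -scalemxAl mxE. Qed.

Lemma dotpNl u w : dotp (- u) w = - dotp u w.
Proof. by rewrite -scaleN1r dotpZl mulN1r. Qed.

Lemma dotpDr u v w : dotp w (u + v) = dotp w u + dotp w v.
Proof. by rewrite dotpC dotpDl !(dotpC w). Qed.

Lemma dotpZr a u w : dotp w (a *: u) = a * dotp w u.
Proof. by rewrite dotpC dotpZl (dotpC w). Qed.

Lemma dotpNr u w : dotp w (- u) = - dotp w u.
Proof. by rewrite dotpC dotpNl (dotpC w). Qed.

Definition dotp_linE := (dotpDl, dotpDr, dotpZl, dotpZr, dotpNl, dotpNr).

Lemma dotp0l w : dotp 0 w = 0.
Proof. by rewrite -(scale0r 0) dotpZl mul0r. Qed.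

Lemma dotp_ge0 u : 0 <= dotp u u.
Proof. by apply: sumr_ge0 => i _; rewrite -expr2 sqr_ge0. Qed.

Lemma dotp_eq0 u : dotp u u = 0 -> u = 0.
Proof.
move=> /eqP; rewrite psumr_eq0 => [/allP u0|i _]; last by rewrite -expr2 sqr_ge0.
apply/rowP => i; rewrite mxE; apply/eqP.
by have := u0 i (mem_index_enum _); rewrite /= -expr2 sqrf_eq0.
Qed.

Lemma dotp_mulmxl u v A : dotp (u *m A^T) v = dotp u (v *m A).
Proof. by rewrite !dotpE trmx_mul mulmxA. Qed.

Lemma sqr_dotp_unit u e : dotp e e = 1 -> dotp u e ^+ 2 <= dotp u u.
Proof.
move=> e1; have := dotp_ge0 (u - dotp u e *: e).
by rewrite !dotp_linE e1 (dotpC e u); nra.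
Qed.

End DotProduct.

(** * A set of diameter 1 obtained by perturbing a ball *)

Section PerturbedBall.
Context {R : realType} {d : nat}.
Variable e : 'rV[R]_d.
Hypothesis e1 : dotp e e = 1.
Implicit Types u w : 'rV[R]_d.

(* The bound in [pball_diff_le1] holds as soon as [8 eps + 152 eps^2 <= 1/2]. *)
Let eps : R := 32^-1.

(** The gradient at a unit vector [u] of the support function [h]. *)
Definition pball_pt u : 'rV[R]_d :=
  2^-1 *: u
  + eps *: ((3 * dotp u e ^+ 2) *: e - (2 * dotp u e ^+ 3) *: u).

Definition pball : set 'rV[R]_d := [set pball_pt u | u in [set u | dotp u u = 1]].

(** The perturbation of [h] is odd, so its gradient is even and cancels between antipodes. *)
Lemma pball_ptN u : pball_pt u - pball_pt (- u) = u.
Proof.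
by apply/rowP => i; rewrite /pball_pt dotpNl !mxE; field.
Qed.

(** With [s = 1 + dotp u w], the unperturbed ball leaves a slack of [s / 2]. The perturbation costs
    at most a small multiple of [s], because [(a + b) ^+ 2] is at most [2 * s], the squared norm of
    [u + w], and [a], [b] lie in [-1, 1]. *)
Lemma pball_diff_le1 u w : dotp u u = 1 -> dotp w w = 1 ->
  dotp (pball_pt u - pball_pt w) (pball_pt u - pball_pt w) <= 1.
Proof.
move=> u1 w1.
have := sqr_dotp_unit (u + w) e1; have := sqr_dotp_unit u e1.
have := sqr_dotp_unit w e1.
rewrite /pball_pt !dotp_linE e1 u1 w1 !(dotpC e) (dotpC w u).
set a := dotp u e; set b := dotp w e; set s := 1 + dotp u w.
have -> : dotp u w = s - 1 by rewrite /s; ring.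
move=> b1 a1 ab; rewrite -subr_ge0.
set m := (a + b) ^+ 2 in ab.
have m0 : 0 <= m by rewrite sqr_ge0.
have ms : m <= 2 * s by lra.
have [aN1 aP1] : -1 <= a /\ a <= 1 by split; nra.
have [bN1 bP1] : -1 <= b /\ b <= 1 by split; nra.
have cube1 : - (a + b) ^+ 3 <= 4 * s.
  have : 0 <= (2 + (a + b)) * m by apply: mulr_ge0 => //; lra.
  by rewrite /m in ms *; nra.
have a3 : -1 <= a ^+ 3 /\ a ^+ 3 <= 1 by split; nra.
have b3 : -1 <= b ^+ 3 /\ b ^+ 3 <= 1 by split; nra.
have s0 : 0 <= s by lra.
have cube2 : s * (a ^+ 3 + b ^+ 3) <= 2 * s by nra.
have sq1 : (a ^+ 2 - b ^+ 2) ^+ 2 <= 4 * m.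
  have -> : (a ^+ 2 - b ^+ 2) ^+ 2 = (a - b) ^+ 2 * m by rewrite /m; ring.
  apply: ler_wpM2r => //; rewrite -subr_ge0.
  rewrite (_ : 4 - _ = (2 - (a - b)) * (2 + (a - b))); last by ring.
  by apply: mulr_ge0; lra.
have sq2 : (a ^+ 3 + b ^+ 3) ^+ 2 <= 9 * m.
  have -> : (a ^+ 3 + b ^+ 3) ^+ 2 = (a ^+ 2 - a * b + b ^+ 2) ^+ 2 * m.
    by rewrite /m; ring.
  apply: ler_wpM2r => //.
  have q0 : 0 <= a ^+ 2 - a * b + b ^+ 2 by nra.
  have q3 : a ^+ 2 - a * b + b ^+ 2 <= 3 by nra.
  by nra.
have ab3 : - (a ^+ 3 * b ^+ 3) * s <= s.
  rewrite -[leRHS]mul1r ler_wpM2r//.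
  by move: (a ^+ 3) (b ^+ 3) a3 b3 => A B a3 b3; nra.
have sq3 : 0 <= (a ^+ 2 - b ^+ 2) ^+ 2 * (a ^+ 2 + b ^+ 2).
  by rewrite mulr_ge0 ?addr_ge0 ?sqr_ge0.
(* Expansion in [eps]: the first-order bracket is at most [8 * s] and the second-order one at most
   [152 * s], the term with factor 12 having a favourable sign. *)
rewrite [X in 0 <= X](_ : _ = s / 2
  - eps * (- (a + b) ^+ 3 + 2 * (s * (a ^+ 3 + b ^+ 3)))
  - eps ^+ 2 * (9 * (a ^+ 2 - b ^+ 2) ^+ 2
     - 12 * ((a ^+ 2 - b ^+ 2) ^+ 2 * (a ^+ 2 + b ^+ 2))
     + 4 * (a ^+ 3 + b ^+ 3) ^+ 2 + 8 * (- (a ^+ 3 * b ^+ 3) * s))).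
  rewrite /eps; move: (a ^+ 3 * b ^+ 3) ((a ^+ 2 - b ^+ 2) ^+ 2 * _) sq3 ab3.
  move: ((a ^+ 3 + b ^+ 3) ^+ 2) sq2 ((a ^+ 2 - b ^+ 2) ^+ 2) sq1.
  move: (s * (a ^+ 3 + b ^+ 3)) cube2 ((a + b) ^+ 3) cube1.
  move=> *; lra.
by rewrite /eps; field.
Qed.

Lemma diameter_pball : diameter pball = 1%E.
Proof.
apply/eqP; rewrite eq_le; apply/andP; split.
  apply: ge_ereal_sup => _ [[_ _] /= [[u u1 <-] [w w1 <-]] <-].
  by rewrite lee_fin -[leRHS]sqrtr1 ler_wsqrtr ?pball_diff_le1.
apply: ereal_sup_ubound; exists (pball_pt e, pball_pt (- e)) => /=.
  by split; [exists e | exists (- e) => //=; rewrite !dotp_linE e1 opprK].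
by rewrite /enorm pball_ptN e1 sqrtr1.
Qed.

Lemma dotp_pball_pt u : dotp u u = 1 ->
  dotp (pball_pt u) u = 2^-1 + eps * dotp u e ^+ 3.
Proof.
by move=> u1; rewrite /pball_pt !dotp_linE u1 (dotpC e u); ring.
Qed.

End PerturbedBall.

(** * From a covering to a cubic identity on slab normals *)

Definition slab_normal (R : realType) (d : nat) (K : set 'rV[R]_d) v :=
  forall y, K y -> `|dotp y v| <= 2^-1 * enorm v.

Lemma universal_cover_cubic (R : realType) (d : nat) (K : set 'rV[R]_d)
    (e : 'rV[R]_d) : dotp e e = 1 -> universal_cover K ->
  exists c beta : 'rV[R]_d, dotp c c = 1 /\
    forall v, slab_normal K v -> dotp v c ^+ 3 = dotp v v * dotp v beta.
Proof.
move=> e1 [_ /(_ _ (diameter_pball e1)) [A [b [AT XK]]]].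
(* These come from [e] and the translation [b], read in the coordinates of [K]; 32 is the inverse of
   [eps]. *)
exists (e *m A), (32 *: (b *m A)); split.
  by rewrite -dotp_mulmxl -mulmxA AT mulmx1.
move=> v Kv; have [->|v0] := eqVneq v 0.
  by rewrite !dotp0l mul0r expr0n.
set n := enorm v.
have n2 : n ^+ 2 = dotp v v by rewrite sqr_sqrtr ?dotp_ge0.
have n0 : 0 < n.
  rewrite lt_neqAle sqrtr_ge0 andbT eq_sym.
  by apply: contra_neq v0 => nE; apply: dotp_eq0; rewrite -n2 nE expr0n.
have AV x : dotp (x *m A^T) (v *m A^T) = dotp x v.
  by rewrite dotp_mulmxl -mulmxA (mulmx1C AT) mulmx1.
pose u := n^-1 *: (v *m A^T).
have u1 : dotp u u = 1.
  by rewrite !dotp_linE AV -n2; field; rewrite gt_eqF.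
have support w : dotp w w = 1 -> w = u \/ w = - u ->
    dotp (pball_pt e w) w - dotp b w <= 2^-1.
  move=> w1 wE; have [|y yK <-] := XK (pball_pt e w); first by exists w.
  rewrite dotpDl addrK; apply: (le_trans (ler_norm _)).
  have -> : `|dotp (y *m A^T) w| = n^-1 * `|dotp y v|.
    by case: wE => ->; rewrite !dotp_linE AV ?normrN normrM ger0_norm// invr_ge0 ltW.
  by rewrite mulrC ler_pdivrMr// Kv.
have Nu1 : dotp (- u) (- u) = 1 by rewrite dotpNl dotpNr opprK.
(* The cubic and translation terms are odd in the direction, so the bounds at [u] and [- u] combine
   into an equality. *)
have := support _ u1 (or_introl erefl); have := support _ Nu1 (or_intror erefl).
rewrite !dotp_pball_pt// dotpNl dotpNr exprNn => le1 le2.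
have : dotp u e ^+ 3 = 32 * dotp b u by lra.
rewrite !dotp_linE dotp_mulmxl (dotpC b) dotp_mulmxl -n2 => uE.
have -> : dotp v (e *m A) = n * (n^-1 * dotp v (e *m A)).
  by rewrite mulrA divff ?mul1r// gt_eqF.
by rewrite exprMn uE; field; rewrite gt_eqF.
Qed.

(** * Rigidity of the normals of the octagon and of [setD3] *)

Definition cubic_rigid (R : realType) (n : nat) (vs : seq 'rV[R]_n) :=
  forall c beta : 'rV[R]_n,
    (forall v, v \in vs -> dotp v c ^+ 3 = dotp v v * dotp v beta) -> c = 0.

Lemma dotp_ebasis (R : realType) (n : nat) (i : 'I_n) (x : 'rV[R]_n) :
  dotp (ebasis R i) x = x 0 i.
Proof.
rewrite /dotp (bigD1 i)//= big1 ?addr0 => [|j ji]; first by rewrite !mxE !eqxx mul1r.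
by rewrite !mxE (negPf ji) andbF mul0r.
Qed.

(** The axes give the coordinates [p ^+ 3], [q ^+ 3] of [beta]; the sum and difference of the
    diagonal equations then factor. If neither [p] nor [q] vanished,
    [p ^+ 2 = 3 * q ^+ 2 = 9 * p ^+ 2] would follow. *)
Lemma octagon_rigid (R : realType) : let e := @ebasis R 2 in
  cubic_rigid [:: e 0; e 1; e 0 + e 1; e 0 - e 1].
Proof.
move=> e c beta H.
have := H (e 0); have := H (e 1); have := H (e 0 + e 1); have := H (e 0 - e 1).
rewrite !inE !eqxx ?orbT => /(_ isT) + /(_ isT) + /(_ isT) + /(_ isT).
rewrite !dotp_linE !dotp_ebasis !mxE !eqxx /=.
set p := c 0 0; set q := c 0 1; set b0 := beta 0 0; set b1 := beta 0 1.
move=> sub add q3 p3.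
have /eqP : p * (3 * q ^+ 2 - p ^+ 2) = 0 by nra.
have /eqP : q * (3 * p ^+ 2 - q ^+ 2) = 0 by nra.
rewrite !mulf_eq0 => qE pE.
have [p0 q0] : p = 0 /\ q = 0.
  move: qE pE; case/orP=> /eqP qE /orP[] /eqP pE.
  - by [].
  - by split=> //; apply/eqP; rewrite -sqrf_eq0; apply/eqP; rewrite qE in pE; lra.
  - by split=> //; apply/eqP; rewrite -sqrf_eq0; apply/eqP; rewrite pE in qE; lra.
  - by split; apply/eqP; rewrite -sqrf_eq0; apply/eqP; lra.
apply/rowP => i; rewrite mxE.
have : val i = 0%N \/ val i = 1%N by case: i => -[|[|]]//; [left|right].
by case=> iE; [rewrite -p0|rewrite -q0]; congr (c _ _); apply: val_inj.
Qed.

Lemma addr_cube_eq (R : realType) (x y : R) :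
  (x + y) ^+ 3 = 2 * (x ^+ 3 + y ^+ 3) ->
  x + y = 0 \/ x ^+ 2 + y ^+ 2 = 4 * (x * y).
Proof.
move=> xy3; have /eqP : (x + y) * (x ^+ 2 + y ^+ 2 - 4 * (x * y)) = 0 by nra.
by rewrite mulf_eq0 subr_eq0 => /orP[] /eqP; [left|right].
Qed.

(** If one variable vanishes, all do. Otherwise each ratio [y / x], [z / y], [x / z] is -1 or one of
    the mutually inverse numbers 2 + sqrt 3 and 2 - sqrt 3, and three such ratios never have product
    1. *)
Lemma addr_cube_eq_cycle (R : realType) (x y z : R) :
  (x + y) ^+ 3 = 2 * (x ^+ 3 + y ^+ 3) ->
  (y + z) ^+ 3 = 2 * (y ^+ 3 + z ^+ 3) ->
  (z + x) ^+ 3 = 2 * (z ^+ 3 + x ^+ 3) -> x = 0.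
Proof.
move=> /addr_cube_eq xy /addr_cube_eq yz /addr_cube_eq zx.
apply/eqP; rewrite -sqrf_eq0; apply/eqP.
by case: xy => xy; case: yz => yz; case: zx => zx; nra.
Qed.

Lemma setD3_rigid (R : realType) : let e := @ebasis R 3 in
  cubic_rigid [:: e 0; e 1; e 2; e 0 + e 1; e 1 + e 2; e 2 + e 0].
Proof.
move=> e c beta H.
have := H (e 0); have := H (e 1); have := H (e 2).
have := H (e 0 + e 1); have := H (e 1 + e 2); have := H (e 2 + e 0).
rewrite !inE !eqxx ?orbT.
move=> /(_ isT) + /(_ isT) + /(_ isT) + /(_ isT) + /(_ isT) + /(_ isT).
rewrite !dotp_linE !dotp_ebasis !mxE !eqxx /=.
set x := c 0 0; set y := c 0 1; set z := c 0 2.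
move=> zx yz xy z3 y3 x3.
(* The basis vectors eliminate [beta]; the factor 2 is the squared norm of a sum of two of them. *)
have xyE : (x + y) ^+ 3 = 2 * (x ^+ 3 + y ^+ 3) by lra.
have yzE : (y + z) ^+ 3 = 2 * (y ^+ 3 + z ^+ 3) by lra.
have zxE : (z + x) ^+ 3 = 2 * (z ^+ 3 + x ^+ 3) by lra.
have x0 : x = 0 by exact: addr_cube_eq_cycle xyE yzE zxE.
have y0 : y = 0 by exact: addr_cube_eq_cycle yzE zxE xyE.
have z0 : z = 0 by exact: addr_cube_eq_cycle zxE xyE yzE.
apply/rowP => i; rewrite mxE.
have : [\/ val i = 0%N, val i = 1%N | val i = 2%N].
  by case: i => -[|[|[|]]]// ?; [constructor 1|constructor 2|constructor 3].
by case=> iE; [rewrite -x0|rewrite -y0|rewrite -z0]; congr (c _ _); apply: val_inj.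
Qed.

(* [f] is an isometric embedding of the factor and [g], its adjoint, is the
   orthogonal projection onto it. *)
Definition isometric_section (R : realType) (m n : nat)
    (f : 'rV[R]_n -> 'rV[R]_m) (g : 'rV[R]_m -> 'rV[R]_n) :=
  (forall w x, dotp (f w) x = dotp w (g x)) /\ cancel f g.

(** * Reduction of products to their factors *)

Section Factors.
Context {R : realType}.

Lemma isometric_section_comp (m n p : nat)
    (f : 'rV[R]_n -> 'rV[R]_m) g (f' : 'rV[R]_p -> 'rV[R]_n) g' :
  isometric_section f g -> isometric_section f' g' ->
  isometric_section (f \o f') (g' \o g).
Proof.
move=> [fg fK] [fg' fK']; split=> [w x|]; first by rewrite /= fg fg'.
exact: can_comp.
Qed.

Lemma dotp_row_mx (m n : nat) (a : 'rV[R]_m) (b : 'rV[R]_n) x :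
  dotp (row_mx a b) x = dotp a (lsubmx x) + dotp b (rsubmx x).
Proof.
by rewrite -{1}[x]hsubmxK !dotpE tr_row_mx mul_row_col mxE.
Qed.

Lemma isometric_section_lsubmx (m n : nat) :
  isometric_section (fun w : 'rV[R]_m => row_mx w (0 : 'rV[R]_n)) lsubmx.
Proof.
by split=> [w x|w]; rewrite ?row_mxKl// dotp_row_mx dotp0l addr0.
Qed.

Lemma isometric_section_rsubmx (m n : nat) :
  isometric_section (fun w : 'rV[R]_n => row_mx (0 : 'rV[R]_m) w) rsubmx.
Proof.
by split=> [w x|w]; rewrite ?row_mxKr// dotp_row_mx dotp0l add0r.
Qed.

Lemma isometric_section_row (k n : nat) (i : 'I_k) :
  isometric_section (fun w : 'rV[R]_n => mxvec ((delta_mx 0 i)^T *m w))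
    (fun x => row i (vec_mx x)).
Proof.
split=> [w x|w].
  by rewrite dotpE -{1}[x]vec_mxK mxvec_dotmul -rowE -dotpE dotpC.
by rewrite mxvecK rowE trmx_delta mulmxA mul_delta_mx -rowE; apply/rowP => j;
  rewrite mxE.
Qed.

(** [f] sends normals of the factor to slab normals of [K] of the same norm, so the cubic identity
    descends to [g c] and [g beta]. *)
Lemma cubic_factor_eq0 (d n : nat) (K : set 'rV[R]_d) (vs : seq 'rV[R]_n)
    (f : 'rV[R]_n -> 'rV[R]_d) g (c beta : 'rV[R]_d) :
  isometric_section f g -> (forall y, K y -> slabs vs (g y)) ->
  cubic_rigid vs ->
  (forall v, slab_normal K v -> dotp v c ^+ 3 = dotp v v * dotp v beta) ->
  g c = 0.
Proof.
move=> [fg fK] Kg rigid cb; apply: (rigid _ (g beta)) => v vvs.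
have ff : dotp (f v) (f v) = dotp v v by rewrite fg fK.
rewrite -!fg -ff; apply: cb => y yK.
by rewrite dotpC fg dotpC /enorm ff; exact: Kg.
Qed.

Lemma rV_power_slabs_not_cover (n k : nat) (vs : seq 'rV[R]_n) :
  cubic_rigid vs -> (0 < k * n)%N -> ~ universal_cover (rV_power (slabs vs) k).
Proof.
move=> rigid kn0.
(* Any unit vector can serve as [e]; positive dimension provides one. *)
have e1 : dotp (ebasis R (Ordinal kn0)) (ebasis R (Ordinal kn0)) = 1.
  by rewrite dotp_ebasis mxE !eqxx.
move=> /(universal_cover_cubic e1)[c [beta [c1 cb]]].
have c0 : c = 0.
  apply: (can_inj vec_mxK); rewrite linear0; apply/row_matrixP => i; rewrite row0.
  exact: (cubic_factor_eq0 (isometric_section_row n i) (fun y yK => yK i) rigid cb).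
by move: c1 => /eqP; rewrite c0 dotp0l eq_sym oner_eq0.
Qed.

Lemma rV_prod_slabs_not_cover (m n k : nat) (us : seq 'rV[R]_m)
    (vs : seq 'rV[R]_n) : cubic_rigid us -> cubic_rigid vs ->
  (0 < m + k * n)%N ->
  ~ universal_cover (rV_prod (slabs us) (rV_power (slabs vs) k)).
Proof.
move=> rigidu rigidv d0.
have e1 : dotp (ebasis R (Ordinal d0)) (ebasis R (Ordinal d0)) = 1.
  by rewrite dotp_ebasis mxE !eqxx.
move=> /(universal_cover_cubic e1)[c [beta [c1 cb]]].
have l0 : lsubmx c = 0.
  by apply: (cubic_factor_eq0 (isometric_section_lsubmx m (k * n)) _ rigidu cb)
    => y [].
have r0 : rsubmx c = 0.
  apply: (can_inj vec_mxK); rewrite linear0; apply/row_matrixP => i; rewrite row0.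
  have sec := isometric_section_comp (isometric_section_rsubmx m (k * n))
    (isometric_section_row n i).
  by apply: (cubic_factor_eq0 sec _ rigidv cb) => y [_ yK]; exact: yK.
by move: c1 => /eqP; rewrite -[c]hsubmxK l0 r0 row_mx0 dotp0l eq_sym oner_eq0.
Qed.

End Factors.

Theorem theorem6 (R : realType) (k : nat) (hk : (1 <= k)%N) :
  ~ universal_cover (rV_power (octagon R) k) /\
  ~ universal_cover (rV_prod (setD3 R) (rV_power (octagon R) k.-1)).
Proof.
split; first by apply: rV_power_slabs_not_cover; rewrite ?muln_gt0 ?hk//;
  exact: octagon_rigid.
by apply: rV_prod_slabs_not_cover => //; [exact: setD3_rigid|exact: octagon_rigid].
Qed.
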